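(* Let $A\in\mathcal{V}$ and let $\theta$ be a congruence of $A$ with $\theta\subseteq Rad(A)$ such that $\theta$ has $CBLP$. If $A/\theta$ is $B$-normal, then $A$ is $B$-normal.
   Context: $\mathcal{V}$ is a congruence modular, semidegenerate variety (no nontrivial algebra has a one-element subalgebra) of finite signature. For $B\in\mathcal{V}$: $Con(B)$ is its congruence lattice with bounds $\Delta_B,\nabla_B$, $[\cdot,\cdot]$ the Freese–McKenzie commutator, $K(B)$ the compact congruences. A congruence $\phi\neq\nabla_B$ is prime if $[\alpha,\beta]\subseteq\phi$ implies $\alpha\subseteq\phi$ or $\beta\subseteq\phi$; $\rho(\theta)$ is the intersection of primes containing $\theta$; $Rad(B)$ is the intersection of all maximal congruences of $B$. $B(Con(B))$ is the Boolean algebra of complemented elements of $Con(B)$. When $K(B)$ is closed under the commutator, the reticulation $L(B)=K(B)/{\equiv}$ ($\alpha\equiv\beta$ iff $\rho(\alpha)=\rho(\beta)$) is a bounded distributive lattice with canonical map $\lambda_B$, mapping $B(Con(B))$ injectively into $B(L(B))$; the reticulation preserves the Boolean center if this map is onto $B(L(B))$. Standing assumption: for every $B\in\mathcal{V}$, $K(B)$ is closed under the commutator and the reticulation of $B$ preserves the Boolean center. A congruence $\theta$ of $A$ has $CBLP$ if for every $\beta\in B(Con(A/\theta))$ there is $\alpha\in B(Con(A))$ with $(\alpha\vee\theta)/\theta=\beta$. An algebra $B\in\mathcal{V}$ is $B$-normal if for all $\chi,\varepsilon\in Con(B)$ with $\chi\vee\varepsilon=\nabla_B$ there exist $\alpha,\beta\in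 B(Con(B))$ with $\chi\vee\alpha=\varepsilon\vee\beta=\nabla_B$ and $[\alpha,\beta]=\Delta_B$. *)

(* Defs.v *)
From mathcomp Require Import all_boot.
From Stdlib Require Import ClassicalEpsilon.
From Stdlib Require List.
Set Implicit Arguments. Unset Strict Implicit. Unset Printing Implicit Defensive.

Record signature := Signature { sig_op : finType; arity : sig_op -> nat }.

Record algebra (S : signature) := Algebra {
  carrier :> Type;
  interp : forall o : sig_op S, ('I_(arity o) -> carrier) -> carrier }.

Inductive term (S : signature) (X : Type) : Type :=
| Var : X -> term S X
| App : forall o : sig_op S, ('I_(arity o) -> term S X) -> term S X.

Fixpoint eval (S : signature) (X : Type) (A : algebra S) (v : X -> A) (t : term S X) : A :=
  match t with
  | Var x => v x
  | App o ts => @interp S A o (fun i => eval v (ts i))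
  end.

(* A variety is an equational class: the models of a set E of identities. *)
Definition in_var (S : signature) (E : term S nat -> term S nat -> Prop) (B : algebra S) :=
  forall s t, E s t -> forall v : nat -> B, eval v s = eval v t.

Section Cong.
Variables (S : signature) (A : algebra S).

Definition rsub (R T : A -> A -> Prop) := forall x y, R x y -> T x y.
Definition req (R T : A -> A -> Prop) := rsub R T /\ rsub T R.

Definition is_con (R : A -> A -> Prop) :=
  [/\ (forall x, R x x), (forall x y, R x y -> R y x),
      (forall x y z, R x y -> R y z -> R x z) &
      (forall o (a b : 'I_(arity o) -> A),
          (forall i, R (a i) (b i)) -> R (@interp S A o a) (@interp S A o b))].

Definition Delta : A -> A -> Prop := fun x y => x = y.
Definition Nabla : A -> A -> Prop := fun _ _ => True.
Definition cmeet (R T : A -> A -> Prop) : A -> A -> Prop := fun x y => R x y /\ T x y.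
Definition Cg (R : A -> A -> Prop) : A -> A -> Prop :=
  fun x y => forall C, is_con C -> rsub R C -> C x y.
Definition cjoin (R T : A -> A -> Prop) : A -> A -> Prop :=
  Cg (fun x y => R x y \/ T x y).
Definition bigjoin (F : (A -> A -> Prop) -> Prop) : A -> A -> Prop :=
  Cg (fun x y => exists R, F R /\ R x y).

Definition compact (a : A -> A -> Prop) :=
  is_con a /\
  forall F : (A -> A -> Prop) -> Prop, (forall R, F R -> is_con R) ->
    rsub a (bigjoin F) ->
    exists l : list (A -> A -> Prop), (forall R, List.In R l -> F R) /\
      rsub a (bigjoin (fun R => List.In R l)).

Definition pairv (a c : nat -> A) : nat + nat -> A :=
  fun z => match z with inl i => a i | inr j => c j end.

Definition centralizes (al be de : A -> A -> Prop) :=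
  forall (t : term S (nat + nat)) (a b c d : nat -> A),
    (forall i, al (a i) (b i)) -> (forall j, be (c j) (d j)) ->
    de (eval (pairv a c) t) (eval (pairv a d) t) ->
    de (eval (pairv b c) t) (eval (pairv b d) t).

Definition comm (al be : A -> A -> Prop) : A -> A -> Prop :=
  fun x y => forall de, is_con de -> centralizes al be de -> de x y.

Definition prime_con (phi : A -> A -> Prop) :=
  is_con phi /\ ~ req phi Nabla /\
  forall al be, is_con al -> is_con be ->
    rsub (comm al be) phi -> rsub al phi \/ rsub be phi.

Definition rho (th : A -> A -> Prop) : A -> A -> Prop :=
  fun x y => forall phi, prime_con phi -> rsub th phi -> phi x y.

Definition maximal_con (phi : A -> A -> Prop) :=
  is_con phi /\ ~ req phi Nabla /\
  forall psi, is_con psi -> rsub phi psi -> req psi phi \/ req psi Nabla.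

Definition Rad : A -> A -> Prop :=
  fun x y => forall phi, maximal_con phi -> phi x y.

Definition boolean_con (al : A -> A -> Prop) :=
  is_con al /\ exists be, is_con be /\ req (cmeet al be) Delta /\ req (cjoin al be) Nabla.

Definition con_modular :=
  forall al be ga, is_con al -> is_con be -> is_con ga -> rsub al ga ->
    req (cmeet (cjoin al be) ga) (cjoin al (cmeet be ga)).

Definition semidegenerate_alg :=
  (exists x y : A, x <> y) -> ~ exists a : A, forall o, @interp S A o (fun _ => a) = a.

Definition K_comm_closed :=
  forall al be, compact al -> compact be -> compact (comm al be).

(* The reticulation L(A) = K(A)/== , with [a] /\ [b] = [[a,b]], [a] \/ [b] = [a \/ b],
   0 = [Delta], 1 = [Nabla], and [a] = [b] iff rho a = rho b.
   lambda_A maps B(Con(A)) onto B(L(A)): every complemented element [a] of L(A)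
   is lambda_A(g) = [g] for some g in B(Con(A)). *)
Definition reticulation_preserves_boolean :=
  forall al, compact al ->
    (exists be, compact be /\ req (rho (cjoin al be)) (rho Nabla) /\
                req (rho (comm al be)) (rho Delta)) ->
    exists ga, boolean_con ga /\ req (rho ga) (rho al).

Definition B_normal :=
  forall chi eps, is_con chi -> is_con eps -> req (cjoin chi eps) Nabla ->
    exists al be, boolean_con al /\ boolean_con be /\
      req (cjoin chi al) Nabla /\ req (cjoin eps be) Nabla /\ req (comm al be) Delta.

End Cong.

Section Quot.
Variables (S : signature) (A : algebra S) (th : A -> A -> Prop).

Definition qcarrier := {P : A -> Prop | exists a, P = th a}.
Definition qcls (a : A) : qcarrier := exist _ (th a) (ex_intro _ a erefl).
Definition qrep (X : qcarrier) : A :=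
  proj1_sig (constructive_indefinite_description _ (proj2_sig X)).

Definition quot_alg : algebra S :=
  @Algebra S qcarrier (fun o X => qcls (@interp S A o (fun i => qrep (X i)))).

(* alpha/theta, for a congruence alpha containing theta *)
Definition qcon (al : A -> A -> Prop) : quot_alg -> quot_alg -> Prop :=
  fun X Y => exists x y, X = qcls x /\ Y = qcls y /\ al x y.

End Quot.

Definition CBLP (S : signature) (A : algebra S) (th : A -> A -> Prop) :=
  forall be : quot_alg th -> quot_alg th -> Prop, boolean_con be ->
    exists al, boolean_con al /\ req (@qcon S A th (cjoin al th)) be.

(* Main.v *)
(* Lift the complemented congruences al', be' provided by B-normality of A/th to
   complemented congruences al, be of A. Since [Nabla] is finitely generated
   (semidegeneracy and a finite signature), joins equal to [Nabla] modulo
   [th <= Rad A] are already equal to [Nabla]; this settles the two join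
   conditions.

   For [al, be] = Delta it suffices that al /\ be = Delta. Semidegeneracy gives
   that C(Nabla, be; de) implies be <= de, and C is additive in its first
   argument, so the hypothesis may be checked on a congruence and a complement.
   In A/th this turns [al', be'] = Delta into al' /\ be' = Delta, whence
   al /\ be <= th <= Rad A. In A, with complements al^c and be^c, it gives
   al^c \/ be^c \/ (al /\ be) = Nabla, so al^c \/ be^c = Nabla; as both
   complements meet al /\ be trivially, C(Nabla, al /\ be; Delta) holds and
   al /\ be = Delta. *)
Require Import Defs.
From mathcomp Require Import all_boot.
From mathcomp Require boolp classical_sets.
From Stdlib Require Import ClassicalEpsilon.
Set Implicit Arguments. Unset Strict Implicit. Unset Printing Implicit Defensive.

(** * Congruences of a single algebra *)

Section Congruences.
Variables (S : signature) (A : algebra S).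
Implicit Types R T C : A -> A -> Prop.

Lemma is_con_Delta : is_con (@Delta S A).
Proof.
split=> [//|x y ->//|x y z -> ->//|o a b ab].
by rewrite (boolp.funext ab : a = b).
Qed.

Lemma is_con_cmeet R T : is_con R -> is_con T -> is_con (cmeet R T).
Proof.
move=> [rR sR tR oR] [rT sT tT oT]; split.
- by move=> x; split.
- by move=> x y [xy1 xy2]; split; [exact: sR | exact: sT].
- by move=> x y z [xy1 xy2] [yz1 yz2]; split; [exact: tR yz1 | exact: tT yz2].
- by move=> o a b ab; split; [apply: oR | apply: oT] => i; case: (ab i).
Qed.

Lemma is_con_Cg R : is_con (Cg R).
Proof.
split.
- by move=> x C [].
- by move=> x y xy C cC RC; case: (cC) => _ sC _ _; apply: sC; exact: xy.
- move=> x y z xy yz C cC RC; case: (cC) => _ _ tC _.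
  by apply: tC; [exact: xy | exact: yz].
- move=> o a b ab C cC RC; case: (cC) => _ _ _ oC.
  by apply: oC => i; exact: ab.
Qed.

Lemma cjoin_ubl R T : rsub R (cjoin R T).
Proof. by move=> x y xy C _; apply; left. Qed.

Lemma cjoin_ubr R T : rsub T (cjoin R T).
Proof. by move=> x y xy C _; apply; right. Qed.

Lemma cjoin_lub R T C : is_con C -> rsub R C -> rsub T C -> rsub (cjoin R T) C.
Proof. by move=> cC RC TC x y; apply=> // u v [/RC|/TC]. Qed.

Lemma cjoin_NablaP R T C :
  req (cjoin R T) (@Nabla S A) -> is_con C -> rsub R C -> rsub T C ->
  forall x y, C x y.
Proof. by move=> [_ RT] cC RC TC x y; apply: (cjoin_lub cC RC TC); exact: RT. Qed.

Lemma comm_le_Delta_centralizes R T :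
  rsub (comm R T) (@Delta S A) -> centralizes R T (@Delta S A).
Proof.
move=> RT t a b c d ab cd eq_ac; apply: RT => C cC zC.
by apply: zC ab cd _; rewrite eq_ac; case: cC.
Qed.

Definition upd n (u : 'I_n -> A) (i : 'I_n) (x : A) : 'I_n -> A :=
  fun k => if k == i then x else u k.

(** Change the arguments one at a time: [mix k] takes its first [k] coordinates from [b] and the
    others from [a]. *)
Lemma compatible_coordinatewise R :
  (forall x, R x x) -> (forall x y z, R x y -> R y z -> R x z) ->
  (forall o (u : 'I_(arity o) -> A) i x y, R x y ->
     R (interp (upd u i x)) (interp (upd u i y))) ->
  forall o (a b : 'I_(arity o) -> A), (forall i, R (a i) (b i)) ->
    R (interp a) (interp b).
Proof.
move=> rR tR uR o a b ab.
pose mix k : 'I_(arity o) -> A := fun j => if j < k then b j else a j.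
have -> : b = mix (arity o) by apply: boolp.funext => j; rewrite /mix ltn_ord.
elim: (arity o) {-2}(arity o) (leqnn (arity o)) => [|m IH] k.
  by rewrite leqn0 => /eqP ->; exact: rR.
case: k => [_|k lek]; first exact: rR.
have [ltk|gek] := ltnP k (arity o); last first.
  have -> : mix k.+1 = mix k; last exact: IH.
  apply: boolp.funext => j; rewrite /mix.
  by rewrite (leq_trans (ltn_ord j) gek) (leq_trans (ltn_ord j)) // leqW.
apply: tR (IH k lek) _; pose i := Ordinal ltk.
have -> : mix k = upd (mix k) i (a i).
  apply: boolp.funext => j; rewrite /upd; case: eqP => // ->.
  by rewrite /mix ltnn.
have -> : mix k.+1 = upd (mix k) i (b i); last exact: uR.
apply: boolp.funext => j; rewrite /upd /mix ltnS leq_eqVlt.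
by rewrite -[j == i]/(nat_of_ord j == k); case: eqP => // jk; congr b; apply: val_inj.
Qed.

(** For the operations, changing one argument at a time involves a single member of the chain. *)
Lemma is_con_chain_union (G : (A -> A -> Prop) -> Prop) :
  (exists C, G C) -> (forall C, G C -> is_con C) ->
  (forall C C', G C -> G C' -> rsub C C' \/ rsub C' C) ->
  is_con (fun x y => exists C, G C /\ C x y).
Proof.
move=> [C0 GC0] cG chG.
have rU x : exists C, G C /\ C x x.
  by exists C0; split=> //; case: (cG _ GC0).
have tU x y z : (exists C, G C /\ C x y) -> (exists C, G C /\ C y z) ->
    exists C, G C /\ C x z.
  move=> [C [GC xy]] [C' [GC' yz]].
  have [_ _ tC _] := cG _ GC; have [_ _ tC' _] := cG _ GC'.
  have [CC'|C'C] := chG _ _ GC GC'.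
    by exists C'; split=> //; apply: tC' yz; exact: CC'.
  by exists C; split=> //; apply: tC xy _; exact: C'C.
split=> //.
- by move=> x y [C [GC xy]]; exists C; split=> //; case: (cG _ GC) => _ sC *; exact: sC.
- apply: (compatible_coordinatewise rU tU) => o u i x y [C [GC xy]].
  exists C; split=> //; have [rC _ _ oC] := cG _ GC.
  by apply: oC => j; rewrite /upd; case: eqP.
Qed.

(** * Translations and syntactic congruences *)

Inductive translation : (A -> A) -> Prop :=
| translation_id : translation id
| translation_op g o (u : 'I_(arity o) -> A) i :
    translation g -> translation (fun x => g (interp (upd u i x))).

(** The largest congruence for which [D] is a union of classes. Compatibility is immediate because
    [translation_op] inserts the new operation innermost. *)
Definition syntactic_con (D : A -> Prop) : A -> A -> Prop :=
  fun x y => forall g, translation g -> (D (g x) <-> D (g y)).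

Lemma is_con_syntactic D : is_con (syntactic_con D).
Proof.
have tR x y z : syntactic_con D x y -> syntactic_con D y z -> syntactic_con D x z.
  by move=> xy yz g tg; rewrite (xy g tg); exact: yz.
split=> //.
- by move=> x y xy g tg; rewrite (xy g tg).
- apply: compatible_coordinatewise => // o u i x y xy g tg.
  exact: xy (translation_op u i tg).
Qed.

Lemma eval_compat X (R : A -> A -> Prop) (t : term S X) v w :
  is_con R -> (forall x, R (v x) (w x)) -> R (eval v t) (eval w t).
Proof. by move=> [_ _ _ oR] vw; elim: t => [z|o ts IH] /=; [exact: vw | exact: oR]. Qed.

(* The shifting lemma: the rows of an (al, be)-matrix lie in [be], its columns
   in [al], so if the first row is in [de] then the second one is in
   [be /\ (al \/ (be /\ de))], which is below [de] by modularity. *)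
Lemma centralizes_of_meet_le (al be de : A -> A -> Prop) :
  con_modular A -> is_con al -> is_con be -> is_con de ->
  rsub (cmeet al be) de -> centralizes al be de.
Proof.
move=> CM cal cbe cde ade t a b c d ab cd ac_ad.
have [ral sal _ _] := cal; have [rbe sbe _ _] := cbe.
have al_col v : al (eval (pairv a v) t) (eval (pairv b v) t).
  by apply: (eval_compat t) => [//|[i|j]] /=.
have be_row v : be (eval (pairv v c) t) (eval (pairv v d) t).
  by apply: (eval_compat t) => [//|[i|j]] /=.
have cbd := is_con_cmeet cbe cde.
have [mod_le _] := CM _ _ _ cbd cal cbe (fun x y => @proj1 _ _).
suff: cjoin (cmeet be de) (cmeet al be) (eval (pairv b c) t) (eval (pairv b d) t).
  by apply: cjoin_lub => // x y [].
apply: mod_le; split; last exact: be_row.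
have [_ _ tJ _] := is_con_Cg (fun x y => cmeet be de x y \/ al x y).
apply: (tJ _ (eval (pairv a c) t)); first by apply: cjoin_ubr; exact: sal.
apply: (tJ _ (eval (pairv a d) t)); last exact: cjoin_ubr.
by apply: cjoin_ubl; split.
Qed.

End Congruences.

Section Variety.
Variables (S : signature) (E : term S nat -> term S nat -> Prop).

Lemma sval_injective (T : Type) (P : T -> Prop) (u v : {x | P x}) :
  sval u = sval v -> u = v.
Proof. by case: u v => [x Px] [y Py] /= xy; exact: boolp.eq_exist. Qed.

(** * Quotient algebras and their congruences *)

Section Quotient.
Variables (A : algebra S) (th : A -> A -> Prop).
Hypothesis cth : is_con th.

Lemma qcls_eqP x y : qcls th x = qcls th y <-> th x y.
Proof.
have [rth sth tth _] := cth; split=> [[->]//|xy].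
apply: boolp.eq_exist; apply: boolp.funext => z; apply: boolp.propext.
by split; apply: tth => //; exact: sth.
Qed.

Lemma qrepK (X : quot_alg th) : qcls th (qrep X) = X.
Proof.
apply: sval_injective; rewrite /qrep /=.
by case: constructive_indefinite_description => a.
Qed.

Lemma qrep_qcls x : th (qrep (qcls th x)) x.
Proof. by apply/qcls_eqP; rewrite (qrepK (qcls th x)). Qed.

Lemma interp_qcls o (a : 'I_(arity o) -> A) :
  interp (a := quot_alg th) (fun i => qcls th (a i)) = qcls th (interp a).
Proof. by apply/qcls_eqP; case: (cth) => _ _ _; apply=> i; exact: qrep_qcls. Qed.

Lemma eval_quot (t : term S nat) (v : nat -> quot_alg th) :
  eval v t = qcls th (eval (fun n => qrep (v n)) t).
Proof.
elim: t => [n|o ts IH]; first by rewrite [LHS]/= -[LHS]qrepK.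
by rewrite -interp_qcls /=; congr qcls; congr interp; apply: boolp.funext => i; rewrite IH.
Qed.

Lemma in_var_quot : in_var E A -> in_var E (quot_alg th).
Proof. by move=> EA s t st v; rewrite !eval_quot (EA _ _ st). Qed.

Lemma qconP C x y : is_con C -> rsub th C ->
  qcon (th := th) C (qcls th x) (qcls th y) <-> C x y.
Proof.
move=> [rC sC tC _] thC; split; last by exists x, y.
move=> [x' [y' [/qcls_eqP xx [/qcls_eqP yy xy]]]].
by apply: tC (thC _ _ xx) (tC _ _ _ xy (sC _ _ (thC _ _ yy))).
Qed.

Lemma is_con_qcon C : is_con C -> rsub th C -> is_con (qcon (th := th) C).
Proof.
move=> cC thC; have [rC sC tC oC] := cC; split.
- by move=> X; rewrite -[X]qrepK; apply/qconP.
- by move=> X Y; rewrite -[X]qrepK -[Y]qrepK => /qconP xy; apply/qconP=> //; apply/sC/xy.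
- move=> X Y Z; rewrite -[X]qrepK -[Y]qrepK -[Z]qrepK => /qconP xy /qconP yz.
  by apply/qconP=> //; apply: tC (xy _ _) (yz _ _).
- move=> o a b ab; apply/qconP=> //; apply: oC => i.
  by apply/(qconP _ _ cC thC); rewrite !qrepK.
Qed.

Lemma is_con_pullback (C : quot_alg th -> quot_alg th -> Prop) :
  is_con C -> is_con (fun x y => C (qcls th x) (qcls th y)).
Proof.
move=> [rC sC tC oC]; split=> [x|x y|x y z|o a b ab] //.
- exact: sC.
- exact: tC.
- by rewrite -!interp_qcls; exact: oC.
Qed.

End Quotient.

Hypothesis Hsd : forall B : algebra S, in_var E B -> semidegenerate_alg B.

(** The class of [d] is a one-element subalgebra of the quotient by [R], so that quotient is
    trivial. *)
Lemma con_collapsing_idempotent_full (A : algebra S) (R : A -> A -> Prop) (d : A) :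
  in_var E A -> is_con R ->
  (forall o : sig_op S, R (interp (fun _ : 'I_(arity o) => d)) d) ->
  forall x y, R x y.
Proof.
move=> EA cR Rd x y; apply: boolp.contrapT => nxy.
apply: (Hsd (in_var_quot cR EA)); first by exists (qcls R x), (qcls R y) => /(qcls_eqP cR).
by exists (qcls R d) => o; rewrite interp_qcls //; apply/qcls_eqP.
Qed.

(** * A congruence as a subalgebra of the square *)

Section PairAlgebra.
Variables (A : algebra S) (be : A -> A -> Prop).
Hypothesis cbe : is_con be.

Lemma pair_closed o (a : 'I_(arity o) -> {p : A * A | be p.1 p.2}) :
  be (interp (fun i => (sval (a i)).1)) (interp (fun i => (sval (a i)).2)).
Proof. by case: cbe => _ _ _; apply=> i; exact: svalP (a i). Qed.

Definition pair_alg : algebra S :=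
  @Algebra S {p : A * A | be p.1 p.2} (fun o a => exist _ (_, _) (pair_closed a)).

Lemma diag_proof (x : A) : be (x, x).1 (x, x).2.
Proof. by case: cbe. Qed.

Definition diag (x : A) : pair_alg := exist _ (x, x) (diag_proof x).

Lemma interp_diag o (a : 'I_(arity o) -> A) :
  interp (fun i => diag (a i)) = diag (interp a).
Proof. exact: boolp.eq_exist. Qed.

Lemma eval_pair X (t : term S X) (v : X -> pair_alg) :
  sval (eval v t) = (eval (fun x => (sval (v x)).1) t, eval (fun x => (sval (v x)).2) t).
Proof.
elim: t => [x|o ts IH] /=; first by case: (sval _).
by congr pair; congr interp; apply: boolp.funext => i; rewrite IH.
Qed.

Lemma in_var_pair : in_var E A -> in_var E pair_alg.
Proof. by move=> EA s t st v; apply: sval_injective; rewrite !eval_pair !(EA _ _ st). Qed.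

Fixpoint tsubst X Y (s : X -> term S Y) (t : term S X) : term S Y :=
  match t with
  | Var x => s x
  | App o ts => App (fun i => tsubst s (ts i))
  end.

Lemma eval_tsubst X Y (s : X -> term S Y) (v : Y -> A) t :
  eval v (tsubst s t) = eval (fun x => eval v (s x)) t.
Proof. by elim: t => //= o ts IH; congr interp; apply: boolp.funext. Qed.

(** A translation of [pair_alg] is a polynomial whose constants are [be]-related pairs; read in each
    coordinate, it has the shape occurring in [centralizes]. *)
Lemma translation_pair_term (x0 : A) (g : pair_alg -> pair_alg) : translation g ->
  exists (t : term S (nat + nat)) (c d : nat -> A), (forall j, be (c j) (d j)) /\
    forall p, sval (g p) = (eval (pairv (fun=> (sval p).1) c) t,
                            eval (pairv (fun=> (sval p).2) d) t).
Proof.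
have [rbe _ _ _] := cbe.
elim=> [|{}g o u i _ [t [c [d [cd gE]]]]].
  by exists (Var S (inl 0)), (fun=> x0), (fun=> x0); split=> // -[[x y] xy].
pose n := arity o.
(* The moving variable is [inl 0]; the fixed arguments [u] occupy the parameters below [n], and the
   older parameters are shifted by [n]. *)
pose s (z : nat + nat) : term S (nat + nat) := match z with
  | inl _ => App (fun k : 'I_n => Var S (if k == i then inl 0 else inr (k : nat)))
  | inr j => Var S (inr (n + j)) end.
pose ext (pr : A * A -> A) (c : nat -> A) j :=
  if insub j is Some k then pr (sval (u k)) else c (j - n).
have extE pr x e : eval (pairv (fun=> pr (sval x)) (ext pr e)) (tsubst s t) =
    eval (pairv (fun=> interp (fun k => pr (sval (upd u i x k)))) e) t.
  rewrite eval_tsubst; congr eval; apply: boolp.funext => -[_|j] /=.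
    congr interp; apply: boolp.funext => k; rewrite /upd; case: eqP => //= _.
    by rewrite /ext valK.
  by rewrite /ext insubF ?addKn // ltnNge leq_addr.
exists (tsubst s t), (ext fst c), (ext snd d); split=> [j|p].
  by rewrite /ext; case: insubP => [k _ _|_]; [exact: (svalP (u k)) | exact: cd].
by rewrite gE (extE fst) (extE snd).
Qed.

(* [al] centralizes [be] modulo [de] exactly when the diagonal embedding sends
   [al] into the syntactic congruence of [de] on [pair_alg], and the inverse
   image of the latter is a congruence: this gives additivity of [centralizes]
   in its first argument. *)
Definition centralizer (de : A -> A -> Prop) : A -> A -> Prop :=
  fun x y => syntactic_con (fun p : pair_alg => de (sval p).1 (sval p).2)
               (diag x) (diag y).

Lemma is_con_centralizer de : is_con (centralizer de).
Proof.
set D := fun p : pair_alg => de (sval p).1 (sval p).2.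
have [rD sD tD oD] := is_con_syntactic D.
rewrite /centralizer -/D; split=> [x|x y|x y z|o a b ab].
- exact: rD.
- exact: sD.
- exact: tD.
- by rewrite -!interp_diag; exact: oD.
Qed.

Lemma centralizes_le_centralizer al de :
  is_con al -> centralizes al be de -> rsub al (centralizer de).
Proof.
move=> [_ sal _ _] zal.
suff half x y : al x y -> forall g, translation g ->
    de (sval (g (diag x))).1 (sval (g (diag x))).2 ->
    de (sval (g (diag y))).1 (sval (g (diag y))).2.
  by move=> x y xy g tg; split; apply: half => //; exact: sal.
move=> xy g /(translation_pair_term x) [t [c [d [cd gE]]]].
by rewrite !gE /=; exact: zal.
Qed.

(* When [centralizer de] is full, the diagonal becomes a one-element
   subalgebra of a quotient of [pair_alg], which semidegeneracy forces to be
   trivial. *)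
Lemma full_centralizer_le de : in_var E A -> is_con de ->
  (forall x y, centralizer de x y) -> rsub be de.
Proof.
move=> EA [rde _ _ _] full x y xy.
set D := fun p : pair_alg => de (sval p).1 (sval p).2.
have /(_ (diag x) (exist _ (x, y) xy)) eqD : forall p q, syntactic_con D p q.
  apply: (con_collapsing_idempotent_full (d := diag x) (in_var_pair EA)).
    exact: is_con_syntactic.
  by move=> o; rewrite interp_diag; exact: full.
have [+ _] := eqD _ (translation_id _).
by apply; exact: rde.
Qed.

End PairAlgebra.

(** The congruence [centralizer] contains both [al] and [al'], so it is full. Fullness of all common
    upper bounds expresses that the join is [Nabla]. *)
Lemma centralized_by_complements_le (A : algebra S) (al al' be de : A -> A -> Prop) :
  in_var E A -> is_con al -> is_con al' -> is_con be -> is_con de ->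
  (forall C, is_con C -> rsub al C -> rsub al' C -> forall x y, C x y) ->
  centralizes al be de -> centralizes al' be de -> rsub be de.
Proof.
move=> EA cal cal' cbe cde full z z'.
apply: (full_centralizer_le (cbe := cbe)) => //.
by apply: full; [exact: is_con_centralizer | exact: centralizes_le_centralizer ..].
Qed.

(** * Complemented and maximal congruences *)

Hypothesis HCM : forall B : algebra S, in_var E B -> con_modular B.

(** The meet is centralized by [al] because it lies below [be], and by the complement of [al]
    because it meets that complement trivially. *)
Lemma boolean_comm_Delta_meet (A : algebra S) (al be : A -> A -> Prop) :
  in_var E A -> boolean_con al -> is_con be -> rsub (comm al be) (@Delta S A) ->
  rsub (cmeet al be) (@Delta S A).
Proof.
move=> EA [cal [al' [cal' [[al0 _] al1]]]] cbe /comm_le_Delta_centralizes zab.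
have cD := is_con_Delta A; have cM := is_con_cmeet cal cbe.
apply: (centralized_by_complements_le EA cal cal' cM cD).
- by move=> C; exact: cjoin_NablaP al1.
- by move=> t a b c d ab cd; apply: zab => // j; case: (cd j).
- apply: centralizes_of_meet_le => //; first exact: HCM.
  by move=> x y [xy' [xy _]]; apply: al0.
Qed.

(* [Nabla] is generated by the finitely many pairs (f(a, ..., a), a), hence it is
   not the union of a chain of proper congruences. *)
Lemma chain_union_proper (A : algebra S) (G : (A -> A -> Prop) -> Prop) :
  in_var E A -> (exists C, G C) -> (forall C, G C -> is_con C) ->
  (forall C C', G C -> G C' -> rsub C C' \/ rsub C' C) ->
  (forall C, G C -> ~ (forall x y, C x y)) ->
  ~ (forall x y, exists C, G C /\ C x y).
Proof.
move=> EA [C0 GC0] cG chG pG full.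
have [a _] : exists a : A, True.
  apply: boolp.contrapT => noA; apply: (pG _ GC0) => x.
  by case: noA; exists x.
suff [C [GC Ca]] : exists C, G C /\ forall o, o \in enum (sig_op S) ->
    C (interp (fun _ : 'I_(arity o) => a)) a.
  apply: (pG _ GC); apply: (con_collapsing_idempotent_full (d := a) EA (cG _ GC)).
  by move=> o; apply: Ca; rewrite mem_enum.
elim: (enum _) => [|o s [C [GC Ca]]]; first by exists C0.
have [C' [GC' C'a]] := full (interp (fun _ : 'I_(arity o) => a)) a.
have [CC'|C'C] := chG _ _ GC GC'.
  exists C'; split=> // o'; rewrite inE => /orP[/eqP->//|os].
  by apply: CC'; exact: Ca.
exists C; split=> // o'; rewrite inE => /orP[/eqP->|]; last exact: Ca.
exact: C'C.
Qed.

Lemma proper_con_le_maximal (A : algebra S) (phi : A -> A -> Prop) :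
  in_var E A -> is_con phi -> ~ (forall x y, phi x y) ->
  exists psi, maximal_con psi /\ rsub phi psi.
Proof.
move=> EA cphi pphi.
(* Adjoining [phi] covers the empty chain: its union then stands for [phi]. *)
pose u (X : A * A -> Prop) := fun x y => X (x, y) \/ phi x y.
pose P X := is_con (u X) /\ ~ (forall x y, u X x y).
have [F FP chF|X [[cX pX] maxX]] := @classical_sets.Zorn_bigcup _ P.
  pose G C := C = phi \/ exists X, F X /\ C = u X.
  have G0 : exists C, G C by exists phi; left.
  have cG C : G C -> is_con C by move=> [->//|[X [/FP[] cX _ ->]]].
  have pG C : G C -> ~ (forall x y, C x y) by move=> [->//|[X [/FP[] _ pX ->]]].
  have chG C C' : G C -> G C' -> rsub C C' \/ rsub C' C.
    move=> [->|[X [FX ->]]] [->|[Y [FY ->]]].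
    - by left.
    - by left=> x y; right.
    - by right=> x y; right.
    - by have [XY|YX] := chF _ _ FX FY; [left|right] => x y [xy|?];
        [left; exact: XY | right | left; exact: YX | right].
  suff UE : u (classical_sets.bigcup F id) = fun x y => exists C, G C /\ C x y.
    by rewrite /P UE; split; [exact: is_con_chain_union | exact: chain_union_proper].
  apply: boolp.funext => x; apply: boolp.funext => y; apply: boolp.propext; split.
    move=> [[X FX Xxy]|xy]; last by exists phi; split; [left|].
    by exists (u X); split; [right; exists X | left].
  move=> [C [[->|[X [FX ->]]] xy]]; first by right.
  by case: xy => [xy|xy]; [left; exists X | right].
exists (u X); split; last by move=> x y; right.
split=> //; split=> [[_ full]|psi cpsi Xpsi]; first by apply: pX => x y; exact: full.
have [full|npsi] := boolp.pselect (forall x y, psi x y).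
  by right; split=> // x y _; exact: full.
left; split=> //; pose Y p := psi p.1 p.2.
have uY : u Y = psi.
  apply: boolp.funext => x; apply: boolp.funext => y; apply: boolp.propext; split.
    by move=> [//|xy]; apply: Xpsi; right.
  by left.
(* Otherwise [Y] would strictly contain the maximal [X]. *)
apply: boolp.contrapT => psiX; apply: (maxX Y); last by rewrite /P uY.
split=> [[x y] xy|YX]; first by apply: Xpsi; left.
by apply: psiX => x y xy; left; apply: YX.
Qed.

(** A maximal congruence above a proper [chi] would contain [th] as well. *)
Lemma cjoin_le_Rad_full (A : algebra S) (chi th : A -> A -> Prop) :
  in_var E A -> is_con chi -> rsub th (@Rad S A) ->
  (forall C, is_con C -> rsub chi C -> rsub th C -> forall x y, C x y) ->
  forall x y, chi x y.
Proof.
move=> EA cchi thR full; apply: boolp.contrapT.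
move=> /(proper_con_le_maximal EA cchi) [psi [mpsi chipsi]].
have [cpsi [npsi _]] := mpsi; apply: npsi; split=> // x y _.
by apply: full => // u v /thR; apply.
Qed.

Lemma boolean_meet_le_Rad (A : algebra S) (al be : A -> A -> Prop) :
  in_var E A -> boolean_con al -> boolean_con be ->
  rsub (cmeet al be) (@Rad S A) -> rsub (cmeet al be) (@Delta S A).
Proof.
move=> EA [cal [al' [cal' [[al0 _] al1]]]] [cbe [be' [cbe' [[be0 _] be1]]]] abR.
have CM := HCM EA; have cD := is_con_Delta A; have cM := is_con_cmeet cal cbe.
(* Modulo [C], [be] is centralized by [al], as their meet lies in [C], and by [al'], itself in [C].
   Hence [be] lies in [C] along with its complement. *)
have J C : is_con C -> rsub al' C -> rsub be' C -> rsub (cmeet al be) C ->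
    forall x y, C x y.
  move=> cC al'C be'C abC; have beC : rsub be C.
    apply: (centralized_by_complements_le EA cal cal' cbe cC).
    - by move=> C'; exact: cjoin_NablaP al1.
    - exact: centralizes_of_meet_le.
    - by apply: centralizes_of_meet_le => // x y [/al'C].
  exact: cjoin_NablaP be1 cC beC be'C.
(* The hypothesis on [Rad] removes the meet of [al] and [be] from this join. *)
have K : forall x y, cjoin al' be' x y.
  apply: (cjoin_le_Rad_full EA (is_con_Cg _) abR) => C cC JC.
  by apply: J => // x y xy; apply: JC; [exact: cjoin_ubl | exact: cjoin_ubr].
apply: (centralized_by_complements_le EA cal' cbe' cM cD).
- by move=> C cC a b x y; apply: (cjoin_lub cC a b).
- by apply: centralizes_of_meet_le => // x y [xy' [xy _]]; apply: al0.
- by apply: centralizes_of_meet_le => // x y [xy' [_ xy]]; apply: be0.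
Qed.

End Variety.

Theorem theorem6p10 (S : signature) (E : term S nat -> term S nat -> Prop)
  (HCM : forall B : algebra S, in_var E B -> con_modular B)
  (Hsd : forall B : algebra S, in_var E B -> semidegenerate_alg B)
  (Hret : forall B : algebra S, in_var E B ->
            K_comm_closed B /\ reticulation_preserves_boolean B)
  (A : algebra S) (HA : in_var E A)
  (th : A -> A -> Prop) (Hth : is_con th)
  (Hrad : rsub th (@Rad S A)) (Hcblp : CBLP th)
  (Hnorm : B_normal (quot_alg th)) :
  B_normal A.
Proof.
move=> chi eps cchi ceps chi_eps.
(* Joining with [th] gives the form in which [CBLP] describes lifted congruences. *)
pose bar R := qcon (th := th) (cjoin R th).
have thJ R : rsub th (cjoin R th) by exact: cjoin_ubr.
have cbar R : is_con (bar R) by apply: is_con_qcon => //; exact: is_con_Cg.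
have bar_in R x y : R x y -> bar R (qcls th x) (qcls th y).
  by move=> xy; exists x, y; split=> //; split=> //; exact: cjoin_ubl.
have bar_le R C : is_con C -> rsub R C -> rsub th C -> rsub (bar R) (qcon (th := th) C).
  move=> cC RC thC _ _ [x [y [-> [-> xy]]]].
  by exists x, y; split=> //; split=> //; apply: (cjoin_lub cC RC thC).
have [|al1 [be1 [bal1 [bbe1 [chi_al [eps_be [al_be _]]]]]]] :=
    Hnorm _ _ (cbar chi) (cbar eps).
  split=> // X Y _ C cC CU; rewrite -[X]qrepK // -[Y]qrepK //.
  apply: (cjoin_NablaP chi_eps (is_con_pullback Hth cC)) => x y xy.
    by apply: CU; left; exact: bar_in.
  by apply: CU; right; exact: bar_in.
have [al [bal [al1_le al_le1]]] := Hcblp _ bal1.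
have [be [bbe [be1_le be_le1]]] := Hcblp _ bbe1.
have [[cal _] [cbe _]] := (bal, bbe).
(* A congruence above [R], [T] and [th] has a full image in the quotient, hence is full; since [th]
   lies in [Rad], the join of [R] and [T] is already [Nabla]. *)
have lift R T T1 : req (cjoin (bar R) T1) (@Nabla _ _) -> rsub T1 (bar T) ->
    req (cjoin R T) (@Nabla _ _).
  move=> RT T1T; split=> // x y _; move: x y.
  apply: (cjoin_le_Rad_full Hsd HA (is_con_Cg _) Hrad) => C cC JC thC x y.
  apply/(qconP Hth _ _ cC thC); apply: (cjoin_NablaP RT).
  - exact: is_con_qcon.
  - by apply: bar_le => // u v uv; apply: JC; exact: cjoin_ubl.
  - by move=> u v /T1T; apply: bar_le => // u' v' uv; apply: JC; exact: cjoin_ubr.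
have meet0 : rsub (cmeet al be) (@Delta _ _).
  apply: (boolean_meet_le_Rad Hsd HCM HA bal bbe) => x y [xal xbe]; apply: Hrad.
  apply/qcls_eqP => //.
  have EQ := in_var_quot Hth HA; case: (bbe1) => cbe1 _.
  apply: (boolean_comm_Delta_meet Hsd HCM EQ bal1 cbe1 al_be).
  by split; [apply: al1_le | apply: be1_le]; exact: bar_in.
exists al, be; split=> //; split=> //; split; first exact: lift al_le1.
split; first exact: lift be_le1.
(* By modularity, the trivial meet makes [al] centralize [be] modulo [Delta]. *)
split=> [x y xy|x _ <- C [rC _ _ _] _]; last exact: rC.
apply: (xy _ (is_con_Delta A)).
exact: (centralizes_of_meet_le (HCM A HA) cal cbe (is_con_Delta A) meet0).
Qed.
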